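(* Let $M=(S,\mathcal{I})$ be a matroid of rank $r$ with family of bases $\mathcal{B}$, let $w\in\mathbb{R}^S$, let $B_{\max}$ be a maximum $w$-weight basis of $M$, and let $B^*$ be a basis of $M$. If $w(B_{\max})>w(B^* )$, then there exist elements $f\in B_{\max}$ and $e\in B^*$ with $w(f)>w(e)$ such that (a) $\delta^*=(w(f)-w(e))/2$ is the optimum value of the Inverse Matroid instance $(M,B^*,w,\|\cdot\|_\infty)$, i.e. $\delta^*=\min\{\|w-w'\|_\infty : w'\in\mathbb{R}^S,\ B^* \text{ is a maximum } w'\text{-weight basis of } M\}$; and (b) $B'=B^*+f-e$ is a basis of $M$ attaining the maximum in $\max\{ (w(B)-w(B^* ))/|B\triangle B^*| : B\in\mathcal{B}\setminus\{B^*\}\}$. Moreover, if both $B_{\max}$ and $B^*$ are given, the value $\delta^*$ can be found using $O(r\log r)$ elementary operations and independence oracle calls.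
   Context: For $X\subseteq S$ and $x\in S$, $X+x=X\cup\{x\}$, $X-x=X\setminus\{x\}$; $w(X)=\sum_{s\in X}w(s)$; $\|p\|_\infty=\max_{s\in S}|p(s)|$; $\triangle$ denotes symmetric difference. The matroid is accessed via an independence oracle. *)

(* Defs.v *)
From HB Require Import structures.
From mathcomp Require Import all_boot all_order all_algebra.
From mathcomp Require Import reals.

Set Implicit Arguments.
Unset Strict Implicit.
Unset Printing Implicit Defensive.

Import Order.TTheory GRing.Theory Num.Theory.
Local Open Scope ring_scope.

Record matroid (S : finType) := Matroid {
  indep : pred {set S};
  indep_set0 : indep set0;
  indep_sub : forall X Y : {set S}, Y \subset X -> indep X -> indep Y;
  indep_aug : forall X Y : {set S}, indep X -> indep Y -> (#|X| < #|Y|)%N ->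
    exists2 y, y \in Y :\: X & indep (y |: X)
}.

Definition basis (S : finType) (M : matroid S) (B : {set S}) : bool :=
  maxset (indep M) B.

Definition rank (S : finType) (M : matroid S) : nat :=
  \max_(X : {set S} | indep M X) #|X|.

Definition symdiff (S : finType) (X Y : {set S}) : {set S} :=
  (X :\: Y) :|: (Y :\: X).

Section Weights.
Variables (R : realType) (S : finType).
Implicit Types (M : matroid S) (w p : S -> R) (X B : {set S}).

Definition weight w X : R := \sum_(s in X) w s.

Definition linf p : R := \big[Num.max/0]_(s : S) `|p s|.

Definition max_weight_basis M w B : Prop :=
  basis M B /\ forall B', basis M B' -> weight w B' <= weight w B.

(* The minimum is attained: [d] is the value of some feasible [w'] and a lower
   bound for the values of all feasible [w']. *)
Definition inverse_matroid_opt M B w (d : R) : Prop :=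
  (exists2 w', max_weight_basis M w' B & linf (fun s => w s - w' s) = d) /\
  (forall w', max_weight_basis M w' B -> d <= linf (fun s => w s - w' s)).

Definition gain_ratio w Bstar B : R :=
  (weight w B - weight w Bstar) / #|symdiff B Bstar|%:R.

Definition attains_max_gain_ratio M w Bstar B : Prop :=
  [/\ basis M B, B != Bstar &
      forall B', basis M B' -> B' != Bstar ->
        gain_ratio w Bstar B' <= gain_ratio w Bstar B].

End Weights.

(* Model of computation.  An algorithm is one fixed closed program of a
   call-by-value functional language.  It mentions neither the ground set, nor
   the matroid, nor the weights; ground set elements and real numbers are
   atomic data.  Every evaluation step, including every weight lookup, every
   arithmetic operation or comparison and every independence oracle call, is
   charged one unit.  For a fixed program each of these steps takes constant
   time on a real RAM with an oracle: compound data and environments are shared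
   through pointers, and variables are de Bruijn indices bounded by the size of
   the program.  In particular the query set of an oracle call is handed over
   as a list that the program has already built, paying for every new cell. *)

Inductive arith := OpAdd | OpSub | OpMul | OpDiv.

Inductive expr :=
| Var of nat
| Let of expr & expr            (* binds one variable in its second argument *)
| Fun of expr                   (* in the body: Var 0 is the argument,
                                   Var 1 is the function itself *)
| App of expr & expr
| Unit
| Pair of expr & expr
| Fst of expr
| Snd of expr
| Inl of expr
| Inr of expr
| Case of expr & expr & expr    (* each branch binds one variable *)
| Const of int
| Arith of arith & expr & expr
| Leq of expr & expr            (* comparison of real numbers *)
| Same of expr & expr           (* equality of ground set elements *)
| Weight of expr
| Indep of expr.                (* oracle call on a list of elements *)

Inductive value (R S : Type) :=
| VUnit
| VReal of R
| VElt of S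
| VPair of value R S & value R S
| VInl of value R S
| VInr of value R S
| VClosure of seq (value R S) & expr.

Arguments VUnit {R S}.
Arguments VReal {R S} _.
Arguments VElt {R S} _.

Section Semantics.
Variables (R : realType) (S : finType) (w : S -> R) (oracle : pred {set S}).
Local Notation value := (value R S).
Implicit Types (rho : seq value) (v : value) (e : expr) (n : nat).

Definition vbool (b : bool) : value := if b then VInl VUnit else VInr VUnit.

Definition vlist (s : seq S) : value :=
  foldr (fun x v => VInr (VPair (VElt x) v)) (VInl VUnit) s.

Definition arith_op (o : arith) : R -> R -> R :=
  match o with
  | OpAdd => fun x y => x + y
  | OpSub => fun x y => x - y
  | OpMul => fun x y => x * y
  | OpDiv => fun x y => x / y
  end.

(* [eval rho e v n]: in the environment [rho], the expression [e] evaluates to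
   [v] in [n] steps. *)
Inductive eval : seq value -> expr -> value -> nat -> Prop :=
| EvVar rho i v : onth rho i = Some v -> eval rho (Var i) v 1
| EvLet rho e1 e2 v1 v2 n1 n2 :
    eval rho e1 v1 n1 -> eval (v1 :: rho) e2 v2 n2 ->
    eval rho (Let e1 e2) v2 (n1 + n2).+1
| EvFun rho e : eval rho (Fun e) (VClosure rho e) 1
| EvApp rho e1 e2 rho' e v2 v n1 n2 n :
    eval rho e1 (VClosure rho' e) n1 -> eval rho e2 v2 n2 ->
    eval (v2 :: VClosure rho' e :: rho') e v n ->
    eval rho (App e1 e2) v (n1 + n2 + n).+1
| EvUnit rho : eval rho Unit VUnit 1
| EvPair rho e1 e2 v1 v2 n1 n2 :
    eval rho e1 v1 n1 -> eval rho e2 v2 n2 ->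
    eval rho (Pair e1 e2) (VPair v1 v2) (n1 + n2).+1
| EvFst rho e v1 v2 n : eval rho e (VPair v1 v2) n -> eval rho (Fst e) v1 n.+1
| EvSnd rho e v1 v2 n : eval rho e (VPair v1 v2) n -> eval rho (Snd e) v2 n.+1
| EvInl rho e v n : eval rho e v n -> eval rho (Inl e) (VInl v) n.+1
| EvInr rho e v n : eval rho e v n -> eval rho (Inr e) (VInr v) n.+1
| EvCaseInl rho e e1 e2 v0 v n0 n :
    eval rho e (VInl v0) n0 -> eval (v0 :: rho) e1 v n ->
    eval rho (Case e e1 e2) v (n0 + n).+1
| EvCaseInr rho e e1 e2 v0 v n0 n :
    eval rho e (VInr v0) n0 -> eval (v0 :: rho) e2 v n ->
    eval rho (Case e e1 e2) v (n0 + n).+1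
| EvConst rho (z : int) : eval rho (Const z) (VReal z%:~R) 1
| EvArith rho o e1 e2 x1 x2 n1 n2 :
    eval rho e1 (VReal x1) n1 -> eval rho e2 (VReal x2) n2 ->
    eval rho (Arith o e1 e2) (VReal (arith_op o x1 x2)) (n1 + n2).+1
| EvLeq rho e1 e2 x1 x2 n1 n2 :
    eval rho e1 (VReal x1) n1 -> eval rho e2 (VReal x2) n2 ->
    eval rho (Leq e1 e2) (vbool (x1 <= x2)) (n1 + n2).+1
| EvSame rho e1 e2 s1 s2 n1 n2 :
    eval rho e1 (VElt s1) n1 -> eval rho e2 (VElt s2) n2 ->
    eval rho (Same e1 e2) (vbool (s1 == s2)) (n1 + n2).+1
| EvWeight rho e s n :
    eval rho e (VElt s) n -> eval rho (Weight e) (VReal (w s)) n.+1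
| EvIndep rho e (s : seq S) n :
    eval rho e (vlist s) n ->
    eval rho (Indep e) (vbool (oracle [set x in s])) n.+1.

Lemma vlist_inj : injective vlist.
Proof. by elim=> [|x s IHs] [|y t] //= [-> /IHs ->]. Qed.

Lemma eval_det rho e v v' n n' :
  eval rho e v n -> eval rho e v' n' -> v = v' /\ n = n'.
Proof.
move=> ev; elim: ev v' n' => {rho e v n} *;
  match goal with H : eval _ _ _ _ |- _ => inversion H; subst; clear H end;
  repeat match goal with
  | IH : forall v' n', eval ?r ?e v' n' -> _, E : eval ?r ?e _ _ |- _ =>
      let Ev := fresh in
      have [Ev ?] := IH _ _ E; clear IH E;
      first [have ? := vlist_inj Ev | inversion Ev | idtac]; subst
  end => //; split=> //; congruence.
Qed.

End Semantics.

(* Main.v *)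
(* Call (f, e) an exchange if f is outside B*, e is in B* and B* + f - e is
   independent.  A basis none of whose exchanges gains weight is a maximum weight
   basis.  Take an exchange maximizing w(f) - w(e) = 2 delta; comparing with the
   circuit of f in Bmax, f can be moved into Bmax.  Raising w by delta on B* and
   lowering it by delta elsewhere makes every exchange unprofitable, so B* becomes
   optimal; this yields both (a) and the bound delta on all gain ratios, which
   (f, e) attains.

   For the algorithm, sort both bases by decreasing weight and run through the
   elements f of Bmax \ B* while growing a prefix d_1, ..., d_k of B*, as long as
   {f, d_1, ..., d_k, d_(k+1)} is independent.  When it is not, every e exchanged
   for f is among d_1, ..., d_(k+1), so w(f) - w(d_(k+1)) is at least the gain of
   (f, e).  It is at most 2 delta as well, because the prefix never shrinks: the
   element g that was used to grow it is no lighter than f and its lightest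
   exchange partner is no heavier than d_(k+1).  So after sorting there are O(r)
   oracle calls, and each query list extends a list already in memory by at most
   two cells. *)
Require Import Defs.
From HB Require Import structures.
From mathcomp Require Import all_boot all_order all_algebra.
From mathcomp Require Import reals zify lra.

Set Implicit Arguments.
Unset Strict Implicit.
Unset Printing Implicit Defensive.

Import Order.TTheory GRing.Theory Num.Theory.
Local Open Scope ring_scope.

(** * Exchanges and maximum weight bases *)

Section Matroid.
Variables (S : finType) (M : matroid S).
Implicit Types (X Y Z A B : {set S}) (e f y : S).

(** Augment [X] from [Y] one element at a time until the sizes agree. *)
Lemma indep_extend X Y : indep M X -> indep M Y -> (#|X| <= #|Y|)%N ->
  exists Z, [/\ X \subset Z, Z \subset X :|: Y, indep M Z & #|Z| = #|Y|].
Proof.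
move=> + iY; have [n] := ubnP (#|Y| - #|X|); elim: n X => // n IHn X ltn iX leXY.
have [eqXY|neqXY] := eqVneq #|X| #|Y|.
  by exists X; split=> //; apply: subsetUl.
have ltXY : (#|X| < #|Y|)%N by rewrite ltn_neqAle neqXY.
have [y /setDP[yY yX] iyX] := indep_aug iX iY ltXY.
have cy : #|y |: X| = #|X|.+1 by rewrite cardsU1 yX.
have [||Z [sZ Zs iZ cZ]] := IHn (y |: X) _ iyX; rewrite ?cy //; first by lia.
exists Z; split=> //; first exact: subset_trans (subsetUr _ _) sZ.
by apply: subset_trans Zs _; rewrite !subUset subsetUl subsetUr sub1set inE yY orbT.
Qed.

Lemma basis_indep B : basis M B -> indep M B.
Proof. by case/maxsetP. Qed.

Lemma basis_max B X : basis M B -> indep M X -> (#|X| <= #|B|)%N.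
Proof.
move=> /maxsetP[iB maxB] iX; rewrite leqNgt; apply/negP => ltBX.
have [y /setDP[_ yB] iy] := indep_aug iB iX ltBX.
by rewrite -(maxB _ iy (subsetUr _ _)) setU11 in yB.
Qed.

Lemma indep_basis B X : basis M B -> indep M X -> #|X| = #|B| -> basis M X.
Proof.
move=> bB iX cX; apply/maxsetP; split=> // Y iY sXY.
by apply/esym/eqP; rewrite eqEcard sXY cX (basis_max bB).
Qed.

Lemma card_basis B : basis M B -> #|B| = rank M.
Proof.
move=> bB; apply/eqP; rewrite eqn_leq; apply/andP; split.
  by apply: (@leq_bigmax_cond _ (indep M) (fun X : {set S} => #|X|)); apply: basis_indep.
by apply/bigmax_leqP => X; apply: basis_max.
Qed.

Lemma basisU1_indep B f : basis M B -> indep M (f |: B) = (f \in B).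
Proof.
move=> bB; apply/idP/idP => [/(basis_max bB)|fB].
  by rewrite cardsU1; case: (f \in B); rewrite //= add1n ltnn.
by rewrite (setUidPr _) ?sub1set // basis_indep.
Qed.

(** If [X] is smaller than [A], augmentation applies. Otherwise [A] grows inside its union with
    [f |: X] to a set larger than [X]. This set avoids [f], because [f |: A] is dependent, so
    augmenting [X] from it uses an element of [A]. *)
Lemma indep_exchange A X f : indep M A -> f \notin X -> indep M (f |: X) ->
  ~~ indep M (f |: A) -> exists2 y, y \in A :\: X & indep M (y |: X).
Proof.
move=> iA fX ifX nfA; have iX := indep_sub (subsetUr _ _) ifX.
have [/(indep_aug iX iA)//|leAX] := ltnP #|X| #|A|.
have cfX : #|f |: X| = #|X|.+1 by rewrite cardsU1 fX.
have [|Z [sAZ sZ iZ cZ]] := indep_extend iA ifX; first by rewrite cfX ltnW.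
have fZ : f \notin Z.
  apply: contra nfA => fZ; apply: indep_sub iZ.
  by rewrite subUset sub1set fZ.
have [|y /setDP[yZ yX] iy] := indep_aug iX iZ; first by rewrite cZ cfX.
exists y => //; rewrite inE yX /=.
have := subsetP sZ y yZ; rewrite !inE (negbTE yX) orbF => /orP[//|/eqP yf].
by rewrite -yf yZ in fZ.
Qed.

Definition exchange B f e := [&& f \notin B, e \in B & indep M ((f |: B) :\ e)].

Lemma exchangeE B f e : exchange B f e -> (f |: B) :\ e = f |: (B :\ e).
Proof.
case/and3P=> fB eB _; apply/setP=> x; rewrite !inE.
by case: (eqVneq x f) => // ->; case: eqVneq => //= fe; rewrite fe eB in fB.
Qed.

Lemma exchange_basis B f e :
  basis M B -> exchange B f e -> basis M ((f |: B) :\ e).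
Proof.
move=> bB ex; have /and3P[fB eB ix] := ex; apply: (indep_basis bB ix).
by rewrite exchangeE // cardsU1 !inE (negbTE fB) andbF -[in RHS](setD1K eB) cardsU1 !inE eqxx.
Qed.

(** Fill [f |: A] up to the size of [B] with elements of [B]: the result is [f |: B] without one
    element, which lies outside [A]. *)
Lemma basis_extend_exchange B A f : basis M B -> A \subset B -> f \notin B ->
  indep M (f |: A) -> exists2 e, exchange B f e & e \notin A.
Proof.
move=> bB sAB fB ifA.
have [|Z [sZ Zs iZ cZ]] := indep_extend ifA (basis_indep bB).
  exact: basis_max bB ifA.
have fZ : f \in Z by apply: (subsetP sZ); rewrite setU11.
have sZB : Z \subset f |: B.
  by apply: subset_trans Zs _; rewrite -setUA (setUidPr sAB).
have [e eB eZ] : exists2 e, e \in B & e \notin Z.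
  apply/subsetPn; apply/negP => sBZ; move: cZ => /eqP; apply/negP.
  have : f |: B \subset Z by rewrite subUset sub1set fZ.
  move/subset_leq_card; rewrite cardsU1 fB add1n.
  by move=> lt; apply: contraTneq lt => ->; rewrite ltnn.
exists e; last by apply: contra eZ => eA; apply: (subsetP sZ); rewrite !inE eA orbT.
rewrite /exchange fB eB /=; suff -> : (f |: B) :\ e = Z by [].
apply/esym/eqP; rewrite eqEcard subsetD1 sZB eZ /=.
by rewrite cZ cardsDS ?sub1set ?inE ?eB ?orbT // cards1 cardsU1 fB addKn.
Qed.

(** * Weights: local optimality, shifted weights and the gain ratio *)

Section Weight.
Variables (R : realType).
Implicit Type w : S -> R.

Lemma weight_exchange w B f e :
  exchange B f e -> weight w ((f |: B) :\ e) = weight w B + w f - w e.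
Proof.
move=> ex; have /and3P[fB eB ix] := ex.
rewrite exchangeE // /weight big_setU1 ?inE ?(negbTE fB) ?andbF //=.
by rewrite (big_setD1 e eB) /=; lra.
Qed.

Lemma max_weight_exchange w B f e :
  max_weight_basis M w B -> exchange B f e -> w f <= w e.
Proof.
move=> [bB maxB] ex; have := maxB _ (exchange_basis bB ex).
by rewrite weight_exchange //; lra.
Qed.

(** The elements of [B] at least as heavy as [f] become dependent when [f] is added: otherwise [f]
    could be exchanged for a lighter element. So [indep_exchange] applies to them. *)
Lemma heavy_exchange w B X f : basis M B ->
    (forall f e, exchange B f e -> w f <= w e) ->
    f \notin B -> f \notin X -> indep M (f |: X) ->
  exists2 y, y \in B :\: X & w f <= w y /\ indep M (y |: X).
Proof.
move=> bB optB fB fX ifX; pose A := [set g in B | w f <= w g].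
have iB := basis_indep bB.
have sAB : A \subset B by apply/subsetP=> x; rewrite inE => /andP[].
have iA : indep M A := indep_sub sAB iB.
have nfA : ~~ indep M (f |: A).
  apply/negP => /(basis_extend_exchange bB sAB fB)[e ex].
  by rewrite inE (optB _ _ ex); case/and3P: ex => _ ->.
have [y /setDP[+ yX] iy] := indep_exchange iA fX ifX nfA.
by rewrite inE => /andP[yB wy]; exists y; rewrite ?inE ?yX.
Qed.

(** Replacing some [f] of [B'] outside [B] by an element of [B] that is no lighter brings [B']
    closer to [B] without losing weight. *)
Lemma local_max_weight_basis w B : basis M B ->
  (forall f e, exchange B f e -> w f <= w e) -> max_weight_basis M w B.
Proof.
move=> bB optB; split=> // B'.
have [n] := ubnP #|B' :\: B|; elim: n B' => // n IHn B' ltn bB'.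
have [/eqP/[!setD_eq0] sB'|] := eqVneq (B' :\: B) set0.
  suff -> : B' = B by [].
  by apply/eqP; rewrite eqEcard sB' (basis_max bB' (basis_indep bB)).
move/set0Pn => [f /[dup] fD /setDP[fB' fB]].
have [||y /setDP[yB yX] [wy iy]] := @heavy_exchange w B (B' :\ f) f bB optB fB.
- by rewrite !inE eqxx.
- by rewrite setD1K // basis_indep.
have yf : y != f by apply: contra fB => /eqP <-.
have yB' : y \notin B' by move: yX; rewrite !inE yf.
have ex : exchange B' y f.
  rewrite /exchange yB' fB'; suff -> : (y |: B') :\ f = y |: B' :\ f by [].
  by apply/setP=> x; rewrite !inE; case: (eqVneq x y) => // ->; rewrite yf.
have c : (#|((y |: B') :\ f) :\: B| < #|B' :\: B|)%N; last first.
  have := IHn _ (leq_trans c ltn) (exchange_basis bB' ex).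
  by rewrite weight_exchange //; lra.
apply: proper_card; apply/properP; split; last by exists f; rewrite // !inE eqxx andbF.
apply/subsetP=> x; rewrite !inE => /and3P[xB xf /orP[/eqP xy|->]]; rewrite xB //.
by rewrite xy yB in xB.
Qed.

Lemma linf_le (p : S -> R) d : 0 <= d -> (forall s, `|p s| <= d) -> linf p <= d.
Proof. by move=> d0 pd; apply: bigmax_le. Qed.

Lemma le_linf (p : S -> R) s : `|p s| <= linf p.
Proof. exact: le_bigmax. Qed.

(** Since [w' f <= w' e], a positive gap [w f - w e] must be closed by changes at [f] and [e], one
    of which is at least half of it. *)
Lemma exchange_le_linf w w' B f e : max_weight_basis M w' B -> exchange B f e ->
  (w f - w e) / 2 <= linf (fun s => w s - w' s).
Proof.
move=> maxB /(max_weight_exchange maxB) le.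
have := le_linf (fun s => w s - w' s) f; have := le_linf (fun s => w s - w' s) e.
by rewrite !ler_norml; move=> /andP[? ?] /andP[? ?]; lra.
Qed.

Lemma inverse_matroid_opt_uniq w B d d' :
  inverse_matroid_opt M B w d -> inverse_matroid_opt M B w d' -> d = d'.
Proof.
move=> [[w1 m1 <-] l1] [[w2 m2 <-] l2].
by apply/eqP; rewrite eq_le l1 // l2.
Qed.

(** Each element of the symmetric difference costs [B'] an amount [d] against [B]. Optimality of [B]
    for the shifted weights thus bounds all gain ratios by [d]. *)
Lemma weight_shift w B B' d :
  weight (fun s => if s \in B then w s + d else w s - d) B' -
  weight (fun s => if s \in B then w s + d else w s - d) B =
  weight w B' - weight w B - d * #|symdiff B' B|%:R.
Proof.
have -> : weight (fun s => if s \in B then w s + d else w s - d) B =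
          weight w B + d *+ #|B|.
  by rewrite -sumr_const -big_split; apply: eq_bigr => s /= ->.
have -> : weight (fun s => if s \in B then w s + d else w s - d) B' =
          weight w B' + d *+ #|B' :&: B| - d *+ #|B' :\: B|.
  rewrite /weight (big_setID B) [in RHS](big_setID B) /=.
  rewrite (eq_bigr (fun s => w s + d)); last by move=> s /setIP[_ ->].
  rewrite [X in _ + X](eq_bigr (fun s => w s - d)); last first.
    by move=> s /setDP[_ /negbTE ->].
  by rewrite !big_split /= sumrN !sumr_const; lra.
have -> : #|symdiff B' B| = (#|B' :\: B| + #|B :\: B'|)%N.
  rewrite /symdiff cardsU; suff -> : (B' :\: B) :&: (B :\: B') = set0.
    by rewrite cards0 subn0.
  by apply/setP=> x; rewrite !inE; case: (x \in B); case: (x \in B').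
rewrite -(cardsID B' B) (setIC B B').
move: #|B' :\: B| #|B :\: B'| #|B' :&: B| (weight w B) (weight w B') => a b c x y.
by rewrite natrD mulrDr !mulr_natr mulrnDr; lra.
Qed.

Lemma symdiff_exchange B f e : exchange B f e ->
  #|symdiff ((f |: B) :\ e) B| = 2.
Proof.
case/and3P=> fB eB _; have fe : f != e by apply: contra fB => /eqP ->.
suff -> : symdiff ((f |: B) :\ e) B = [set f; e] by rewrite cards2 fe.
apply/setP=> x; rewrite !inE.
case: (eqVneq x f) => [->|xf]; first by rewrite fe (negbTE fB).
by case: (eqVneq x e) => [->|xe]; rewrite ?eB //=; case: (x \in B).
Qed.

Lemma gain_ratio_exchange w B f e : exchange B f e ->
  gain_ratio w B ((f |: B) :\ e) = (w f - w e) / 2.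
Proof.
move=> ex; rewrite /gain_ratio symdiff_exchange // weight_exchange //.
by congr (_ / _); lra.
Qed.

Lemma best_exchange w Bmax B : max_weight_basis M w Bmax -> basis M B ->
    weight w B < weight w Bmax ->
  exists f e, [/\ f \in Bmax, exchange B f e, w e < w f,
    inverse_matroid_opt M B w ((w f - w e) / 2) &
    attains_max_gain_ratio M w B ((f |: B) :\ e)].
Proof.
move=> maxBm bB lt.
pose P (p : S * S) := exchange B p.1 p.2.
have [p0 Pp0 lt0] : exists2 p, P p & w p.2 < w p.1.
  case: (boolP [exists p, P p && (w p.2 < w p.1)]) => [/existsP[p /andP[]]|].
    by exists p.
  rewrite negb_exists => /forallP no.
  have [f e ex|_ /(_ _ maxBm.1)] := @local_max_weight_basis w B bB.
    by have := no (f, e); rewrite /P ex /= -leNgt.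
  by rewrite leNgt lt.
pose F p : R := w p.1 - w p.2.
have [[f0 e] Pf0 bestP] := @Order.TotalTheory.arg_maxP _ _ _ p0 P F Pp0.
have bestF p : P p -> F p <= F (f0, e) by apply: bestP.
have lef0 f e' : exchange B f e' -> w f - w e' <= w f0 - w e.
  by move=> ex; apply: (bestF (f, e')).
have {}lt0 : w e < w f0 by have := bestF _ Pp0; rewrite /F /=; lra.
(* The best [f0] may lie outside [Bmax]; [heavy_exchange] with [B :\ e] replaces it by an element of
   [Bmax] that is no lighter. Being heavier than [e], this element is not [e], hence lies outside
   [B]. *)
have [f [fBm ex wf]] : exists f, [/\ f \in Bmax, exchange B f e & w f0 <= w f].
  have [f0m|f0m] := boolP (f0 \in Bmax); first by exists f0.
  have /and3P[f0B eB] := Pf0; rewrite (exchangeE Pf0) /= => i0.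
  have [] := @heavy_exchange w Bmax (B :\ e) f0 maxBm.1 _ f0m _ i0.
  - by move=> f' e'; apply: max_weight_exchange.
  - by rewrite !inE (negbTE f0B) andbF.
  move=> y /setDP[yBm yB] [wy iy]; exists y; split=> //.
  have ye : y != e by apply: contraTneq lt0 => <-; rewrite -leNgt.
  have {}yB : y \notin B by move: yB; rewrite !inE ye.
  rewrite /exchange yB eB; suff -> : (y |: B) :\ e = y |: B :\ e by [].
  by apply/setP=> x; rewrite !inE; case: (eqVneq x y) => // ->; rewrite ye.
have {}bestF f' e' : exchange B f' e' -> w f' - w e' <= w f - w e.
  by move=> /lef0; lra.
have {wf}lt0 : w e < w f by lra.
pose d := (w f - w e) / 2; have d0 : 0 < d by rewrite /d; lra.
pose w' s := if s \in B then w s + d else w s - d.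
have maxB : max_weight_basis M w' B.
  apply: local_max_weight_basis => // f' e' ex'.
  have := bestF _ _ ex'; rewrite /w'; case/and3P: ex' => /negbTE -> -> _.
  by rewrite /d; lra.
exists f, e; split=> //.
  split=> [|w1 m1]; last exact: exchange_le_linf m1 ex.
  exists w' => //; apply/eqP; rewrite eq_le (exchange_le_linf _ maxB ex) andbT.
  apply: linf_le => [|s]; first exact: ltW.
  by rewrite /w'; case: ifP => _; rewrite ler_norml -/d; apply/andP; split; lra.
split.
- exact: exchange_basis.
- apply/eqP => eqB; have := setD11 e (f |: B); rewrite eqB.
  by case/and3P: ex => _ ->.
move=> B' bB' neq; rewrite (gain_ratio_exchange _ ex) -/d /gain_ratio.
rewrite ler_pdivrMr; first by have := maxB.2 _ bB'; have := weight_shift w B B' d; rewrite -/w'; lra.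
rewrite ltr0n lt0n; apply: contra neq => /eqP/cards0_eq/setP eq0.
by apply/eqP/setP=> x; have := eq0 x; rewrite !inE; case: (x \in B'); case: (x \in B).
Qed.

End Weight.
End Matroid.

(** * The algorithm *)

(* Each [..._body] is the body of a recursive function: on entry [Var 0] is its
   argument and [Var 1] the function itself. *)
Definition split_body : expr :=
  Case (Var 0)
    (Pair (Inl Unit) (Inl Unit))
    (Let (App (Var 2) (Snd (Var 0)))
      (Pair (Inr (Pair (Fst (Var 1)) (Snd (Var 0)))) (Fst (Var 0)))).

Definition merge_body : expr :=
  Case (Fst (Var 0))
    (Snd (Var 1))
    (Case (Snd (Var 1))
      (Fst (Var 2))
      (Case (Leq (Weight (Fst (Var 0))) (Weight (Fst (Var 1))))
        (Inr (Pair (Fst (Var 2)) (App (Var 4) (Pair (Snd (Var 2)) (Snd (Var 3))))))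
        (Inr (Pair (Fst (Var 1)) (App (Var 4) (Pair (Fst (Var 3)) (Snd (Var 1)))))))).

Definition sort_body : expr :=
  Case (Var 0)
    (Inl Unit)
    (Case (Snd (Var 0))
      (Var 2)
      (Let (App (Fun split_body) (Var 2))
        (App (Fun merge_body)
          (Pair (App (Var 4) (Fst (Var 0))) (App (Var 4) (Snd (Var 0))))))).

(* The argument is [((fs, best), (ds, p))]: [fs] and [ds] are the unread parts of
   the sorted bases, [p] is the current prefix in reverse order and [best] the
   largest gain seen.  [Var 2] on entry is the list of B*; since B* is a basis,
   the query [f :: B*] decides membership of [f] in B*. *)
Definition loop_body : expr :=
  Case (Fst (Fst (Var 0)))
    (Snd (Fst (Var 1)))
    (Case (Indep (Inr (Pair (Fst (Var 0)) (Var 3))))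
      (App (Var 3) (Pair (Pair (Snd (Var 1)) (Snd (Fst (Var 2)))) (Snd (Var 2))))
      (Case (Fst (Snd (Var 2)))
        (Snd (Fst (Var 3)))
        (Case (Indep (Inr (Pair (Fst (Var 2))
                 (Inr (Pair (Fst (Var 0)) (Snd (Snd (Var 3))))))))
          (App (Var 5)
            (Pair (Fst (Var 4))
              (Pair (Snd (Var 1)) (Inr (Pair (Fst (Var 1)) (Snd (Snd (Var 4))))))))
          (Let (Arith OpSub (Weight (Fst (Var 3))) (Weight (Fst (Var 1))))
            (App (Var 6)
              (Pair
                (Pair (Snd (Var 4))
                  (Case (Leq (Snd (Fst (Var 5))) (Var 0))
                    (Var 1) (Snd (Fst (Var 6)))))
                (Snd (Var 5)))))))).

(** The input is the pair of the two bases. Binding the second one before the loop is closed makes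
    it the [Var 2] that [loop_body] reads. *)
Definition inverse_program : expr :=
  Arith OpDiv
    (Let (Snd (Var 0))
      (App (Fun loop_body)
        (Pair (Pair (App (Fun sort_body) (Fst (Var 1))) (Const 0))
              (Pair (App (Fun sort_body) (Var 0)) (Inl Unit)))))
    (Const 2).

(** Derives evaluations of straight-line code; [Case], [App] and oracle calls are left to be treated
    by hand. *)
Ltac ev :=
  first
  [ apply: EvVar; reflexivity | apply: EvFun | apply: EvUnit | apply: EvConst
  | apply: EvLet; [ev|ev] | apply: EvPair; [ev|ev]
  | apply: EvFst; ev | apply: EvSnd; ev | apply: EvInl; ev | apply: EvInr; ev
  | apply: EvArith; [ev|ev] | apply: EvLeq; [ev|ev] | apply: EvWeight; ev
  | eassumption | idtac ].

(** * Correctness and cost of merge sort *)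

Section Semantics.
Variables (R : realType) (S : finType) (w : S -> R) (oracle : pred {set S}).
Local Notation value := (value R S).
Local Notation eval := (eval w oracle).
Local Notation vlist := (vlist R).
Implicit Types (rho : seq value) (v : value) (s l : seq S).

Lemma eval_ifT rho e e1 e2 (b : bool) v n0 n :
  eval rho e (vbool _ _ b) n0 -> b -> eval (VUnit :: rho) e1 v n ->
  eval rho (Case e e1 e2) v (n0 + n).+1.
Proof. by case: b => // ? _; apply: EvCaseInl; eassumption. Qed.

Lemma eval_ifF rho e e1 e2 (b : bool) v n0 n :
  eval rho e (vbool _ _ b) n0 -> b = false -> eval (VUnit :: rho) e2 v n ->
  eval rho (Case e e1 e2) v (n0 + n).+1.
Proof. by case: b => // ? _; apply: EvCaseInr; eassumption. Qed.

Lemma eval_indepT rho e e1 e2 s v n0 n :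
  eval rho e (vlist s) n0 -> oracle [set x in s] -> eval (VUnit :: rho) e1 v n ->
  eval rho (Case (Indep e) e1 e2) v (n0.+1 + n).+1.
Proof. by move=> /EvIndep; apply: eval_ifT. Qed.

Lemma eval_indepF rho e e1 e2 s v n0 n :
  eval rho e (vlist s) n0 -> ~~ oracle [set x in s] -> eval (VUnit :: rho) e2 v n ->
  eval rho (Case (Indep e) e1 e2) v (n0.+1 + n).+1.
Proof. by move=> /EvIndep ev_e /negbTE; apply: eval_ifF. Qed.

(** Keeps the comparison undecided, so that the update of the best gain is derived once for both
    outcomes. *)
Lemma eval_choose rho e e1 e2 (b : bool) (x1 x2 : R) n0 n1 n2 :
  eval rho e (vbool _ _ b) n0 ->
  eval (VUnit :: rho) e1 (VReal x1) n1 -> eval (VUnit :: rho) e2 (VReal x2) n2 ->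
  eval rho (Case e e1 e2) (VReal (if b then x1 else x2))
    (n0 + if b then n1 else n2).+1.
Proof. by case: b => ? ? ?; [apply: EvCaseInl|apply: EvCaseInr]; eassumption. Qed.

(** Swapping the two lists at each element deals the elements out alternately, as [split_body]
    does. *)
Fixpoint halves s : seq S * seq S :=
  if s is x :: s' then (x :: (halves s').2, (halves s').1) else ([::], [::]).

Lemma perm_halves s : perm_eq ((halves s).1 ++ (halves s).2) s.
Proof.
by elim: s => //= x s IHs; rewrite perm_cons (perm_trans _ IHs) // perm_catC.
Qed.

Lemma size_halves s :
  size (halves s).1 = uphalf (size s) /\ size (halves s).2 = (size s)./2.
Proof. by elim: s => //= x s [-> ->]. Qed.

(** The environment is the one that [EvApp] builds on entering the body, so the induction hypothesis
    fits the recursive call. The later evaluation lemmas have the same form. *)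
Lemma eval_split rho s : exists n,
  eval (vlist s :: VClosure rho split_body :: rho) split_body
    (VPair (vlist (halves s).1) (vlist (halves s).2)) n /\ (n <= 20 * (size s).+1)%N.
Proof.
elim: s => [|x s [n [IHs len]]].
  by eexists; split; [apply: EvCaseInl; ev|].
eexists; split.
  apply: EvCaseInr; first by ev.
  apply: EvLet; first by apply: EvApp; first [exact: IHs | ev].
  by ev.
by rewrite /=; lia.
Qed.

Definition heavier (x y : S) : bool := w y <= w x.

Lemma eval_merge rho s1 s2 : exists n,
  eval (VPair (vlist s1) (vlist s2) :: VClosure rho merge_body :: rho) merge_body
    (vlist (merge heavier s1 s2)) n /\ (n <= 40 * (size s1 + size s2).+1)%N.
Proof.
elim: s1 s2 => [|x s1 IHs1] s2.
  by eexists; split; [apply: EvCaseInl; ev|lia].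
elim: s2 => [|y s2 [n2 [IHs2 le2]]].
  by eexists; split; [apply: EvCaseInr; [|apply: EvCaseInl]; ev|lia].
have [n1 [{}IHs1 le1]] := IHs1 (y :: s2).
rewrite /= in le1 le2 *; case: ifP => hxy; eexists; split.
- apply: EvCaseInr; first by ev.
  apply: EvCaseInr; first by ev.
  apply: eval_ifT hxy _; first by ev.
  by apply: EvInr; apply: EvPair; [ev|apply: EvApp; first [exact: IHs1|ev]].
- by lia.
- apply: EvCaseInr; first by ev.
  apply: EvCaseInr; first by ev.
  apply: eval_ifF hxy _; first by ev.
  by apply: EvInr; apply: EvPair; [ev|apply: EvApp; first [exact: IHs2|ev]].
by lia.
Qed.

Lemma heavier_total : total heavier.
Proof. by move=> x y; apply: le_total. Qed.

(** Both halves lie one level lower, which bounds the depth of the recursion in merge sort. *)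
Lemma up_log2_half n : (2 <= n)%N ->
  ((up_log 2 (uphalf n)).+1 <= up_log 2 n /\ (up_log 2 n./2).+1 <= up_log 2 n)%N.
Proof.
case: n => [|[|n]] // _.
rewrite (@up_log2S n.+1) //= !ltnS.
split; apply: leq_up_log; rewrite ?ltnS uphalfE; lia.
Qed.

Lemma eval_sort rho s : exists s' n,
  [/\ sorted heavier s', perm_eq s' s,
  eval (vlist s :: VClosure rho sort_body :: rho) sort_body (vlist s') n &
  (n <= 200 * (size s * up_log 2 (size s)) + 20)%N].
Proof.
have [k] := ubnP (size s); elim: k s rho => // k IHk s rho ltk.
case def_s: s => [|x [|y s']].
- exists [::]; eexists; split; [by []|by []|by apply: EvCaseInl; ev|by []].
- exists [:: x]; eexists; split; [by []|by []| |].
    by apply: EvCaseInr; [ev|apply: EvCaseInl; ev].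
  by [].
rewrite -def_s.
have s_ge2 : (2 <= size s)%N by rewrite def_s.
have [sz1 sz2] := size_halves s.
have [s1 [n1 [so1 p1 e1 le1]]] := IHk (halves s).1 rho
  ltac:(rewrite sz1 uphalfE; lia).
have [s2 [n2 [so2 p2 e2 le2]]] := IHk (halves s).2 rho ltac:(rewrite sz2; lia).
pose rho' := [:: VPair (VElt y) (vlist s'), VPair (VElt x) (vlist (y :: s')),
                vlist s, VClosure rho sort_body & rho].
have [n3 [e3 le3]] := eval_split rho' s.
pose rho'' := VPair (vlist (halves s).1) (vlist (halves s).2) :: rho'.
have [n4 [e4 le4]] := eval_merge rho'' s1 s2.
exists (merge heavier s1 s2); eexists; split.
- exact: (merge_sorted heavier_total so1 so2).
- by rewrite perm_merge (perm_trans (perm_cat p1 p2)) ?perm_halves.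
- apply: EvCaseInr; first by apply: EvVar; rewrite def_s.
  apply: EvCaseInr; first by ev.
  apply: EvLet; first by apply: EvApp; [ev|ev|exact: e3].
  apply: EvApp; [ev| |exact: e4].
  apply: EvPair; first by apply: EvApp; [ev|ev|exact: e1].
  by apply: EvApp; [ev|ev|exact: e2].
have [L1 L2] := up_log2_half s_ge2.
rewrite (perm_size p1) (perm_size p2) sz1 sz2 in le1 le2 le4.
have : (size s = uphalf (size s) + (size s)./2)%N by rewrite uphalfE; lia.
case: (up_log 2 (size s)) L1 L2 => // K; rewrite !ltnS => L1 L2 sz.
(* With the logarithm written [K.+1], the recursive calls use up the terms with factor [K]; the
   remaining [size s] pays for splitting and merging. *)
have := leq_mul (leqnn (uphalf (size s))) L1.
have := leq_mul (leqnn (size s)./2) L2.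
have : (size s * K.+1 = uphalf (size s) * K + (size s)./2 * K + size s)%N.
  by rewrite mulnS -mulnDl -sz addnC.
lia.
Qed.

End Semantics.

(** * Correctness and cost of the main loop *)

Section Loop.
Variables (R : realType) (S : finType) (w : S -> R) (M : matroid S).
Variables (B : {set S}) (sB : seq S).
Hypotheses (bB : basis M B) (set_sB : [set x in sB] = B).
Local Notation eval := (eval w (indep M)).
Local Notation vlist := (vlist R).
Local Notation heavier := (heavier w).

Lemma heavier_trans : transitive heavier.
Proof. by move=> x y z yx xz; apply: le_trans xz yx. Qed.

(** Later instantiated with the largest exchange gain. *)
Variable D : R.
Hypothesis exchange_le : forall f e, exchange M B f e -> w f - w e <= D.

(** The hypothesis on unread elements is the invariant: each has a witness [g], no lighter and
    outside [B], that is still independent with the prefix. Every iteration consumes an element of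
    [fs] or [ds] at constant cost. *)
Lemma eval_loop rho0 (fs ds p : seq S) best :
  sorted heavier fs -> sorted heavier (catrev p ds) -> catrev p ds =i B ->
  (forall f, f \in fs -> f \notin B -> exists g,
     [/\ g \notin B, w f <= w g & indep M (g |: [set x in p])]) ->
  best <= D ->
  let rho := vlist sB :: rho0 in
  exists best' n,
    [/\ eval [:: VPair (VPair (vlist fs) (VReal best)) (VPair (vlist ds) (vlist p)),
                 VClosure rho loop_body & rho] loop_body (VReal best') n,
        best <= best' <= D,
        forall f e, f \in fs -> exchange M B f e -> w f - w e <= best' &
        (n <= 60 * (size fs + size ds).+1)%N].
Proof.
move=> + + + + + rho.
have [k] := ubnP (size fs + size ds).
elim: k fs ds p best => // k IHk [|f fs] ds p best ltk sfs sds eB inv leD.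
  exists best; eexists; split; first by apply: EvCaseInl; ev.
  - by rewrite lexx.
  - by [].
  - by rewrite /=; lia.
have [fB|fB] := boolP (f \in B).
  have [|||b' [n [e1 lb hb len]]] := IHk fs ds p best _ _ sds eB _ leD.
  - by move: ltk; clear=> /=; lia.
  - exact: path_sorted sfs.
  - by move=> g gfs; apply: inv; rewrite inE gfs orbT.
  exists b'; eexists; split.
  - apply: EvCaseInr; first by ev.
    apply: (@eval_indepT _ _ _ _ _ _ _ _ (f :: sB)).
    + by ev.
    + by rewrite set_cons set_sB basisU1_indep.
    + by apply: EvApp; [ev|ev|exact: e1].
  - by [].
  - move=> g e; rewrite inE => /orP[/eqP-> /and3P[]|]; first by rewrite fB.
    exact: hb.
  - by move: len; clear=> /=; lia.
have [g [gB wg ig]] := inv f (mem_head _ _) fB.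
have sub_p : [set x in p] \subset B.
  by apply/subsetP=> x; rewrite inE -eB catrevE mem_cat mem_rev => ->.
case: ds => [|d ds] in ltk sds eB *.
  (* The prefix cannot be all of [B], as the witness [g] extends it. *)
  have eqB : [set x in p] = B.
    by apply/setP=> x; rewrite inE -eB catrevE cats0 mem_rev.
  by rewrite eqB basisU1_indep // (negbTE gB) in ig.
have [ifd|nfd] := boolP (indep M [set x in [:: f, d & p]]).
  have [||b' [n [e1 lb hb len]]] := IHk (f :: fs) ds (d :: p) best _ sfs sds eB _ leD.
  - by move: ltk; clear=> /=; lia.
  (* The current [f] becomes the witness for the longer prefix, since all unread elements are no
     heavier. *)
  - move=> f' f'fs f'B; exists f; split=> //; last by rewrite -set_cons.
    move: f'fs; rewrite inE => /orP[/eqP-> //|].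
    by have /allP := order_path_min heavier_trans sfs; apply.
  exists b'; eexists; split; [|by []|by []|].
  - apply: EvCaseInr; first by ev.
    apply: (@eval_indepF _ _ _ _ _ _ _ _ (f :: sB)).
    + by ev.
    + by rewrite set_cons set_sB basisU1_indep.
    + apply: EvCaseInr; first by ev.
      apply: (@eval_indepT _ _ _ _ _ _ _ _ [:: f, d & p] _ _ _ _ ifd).
      * by ev.
      * by apply: EvApp; [ev|ev|exact: e1].
  - by move: len; clear=> /=; lia.
move: (sds); rewrite catrevE (sorted_pairwise heavier_trans) pairwise_cat /=.
case/and3P=> /allrelP prel _ /andP[/allP drel _].
(* Some [e] outside the prefix is exchangeable for [g]; it is no heavier than [d], while [g] is no
   lighter than [f]. *)
have cand_le : w f - w d <= D.
  have [e ex eP] := basis_extend_exchange bB sub_p gB ig.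
  have we : w e <= w d.
    have /and3P[_ + _] := ex; rewrite -eB catrevE mem_cat mem_rev.
    rewrite inE in eP; rewrite (negbTE eP) inE /= => /orP[/eqP-> //|].
    exact: drel.
  by have := exchange_le ex; lra.
(* If [e] were outside [d :: p], then [f], [d] and [p] would all survive in the exchanged basis,
   against [nfd]. *)
have cand_ge e : exchange M B f e -> w f - w e <= w f - w d.
  move=> ex; suff : e \in d :: p.
    rewrite lerD2l lerN2 inE => /orP[/eqP-> //|ep].
    by apply: prel; rewrite ?mem_rev ?mem_head.
  apply: contraNT nfd => edp; have /and3P[_ eB' ix] := ex.
  apply: indep_sub ix; rewrite set_cons subsetD1; apply/andP; split.
    apply: setUS; apply/subsetP=> x; rewrite inE -eB catrevE mem_cat mem_rev !inE.
    by case/orP=> [/eqP->|->]; rewrite ?eqxx ?orbT.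
  rewrite in_setU1 inE negb_or edp andbT.
  by apply: contra fB => /eqP <-.
have [||||b' [n [e1 lb hb len]]] :=
  IHk fs (d :: ds) p (if best <= w f - w d then w f - w d else best) _ _ sds eB _ _.
- by move: ltk; clear=> /=; lia.
- exact: path_sorted sfs.
- by move=> g' gfs; apply: inv; rewrite inE gfs orbT.
- by case: ifP.
exists b'; eexists; split.
- apply: EvCaseInr; first by ev.
  apply: (@eval_indepF _ _ _ _ _ _ _ _ (f :: sB)).
  + by ev.
  + by rewrite set_cons set_sB basisU1_indep.
  + apply: EvCaseInr; first by ev.
    apply: (@eval_indepF _ _ _ _ _ _ _ _ [:: f, d & p] _ _ _ _ nfd).
    * by ev.
    * apply: EvLet; first by ev.
      apply: EvApp; [ev| |exact: e1].
      apply: EvPair; last by ev.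
      apply: EvPair; first by ev.
      by apply: eval_choose; ev.
- by move: lb; case: ifP => //; lra.
- move=> f' e; rewrite inE => /orP[/eqP->|]; last exact: hb.
  move=> /cand_ge; move: lb; case: ifP => [_|/negbT]; rewrite -?ltNge; lra.
- by move: len; clear=> /=; case: ifP => _; lia.
Qed.

End Loop.

Theorem theorem3p3 (R : realType) :
  (forall (S : finType) (M : matroid S) (w : S -> R) (Bmax Bstar : {set S}),
     max_weight_basis M w Bmax -> basis M Bstar ->
     weight w Bstar < weight w Bmax ->
     exists f e : S,
       [/\ f \in Bmax, e \in Bstar, w e < w f,
           inverse_matroid_opt M Bstar w ((w f - w e) / 2) &
           attains_max_gain_ratio M w Bstar ((f |: Bstar) :\ e)])
  /\
  (exists (P : expr) (C : nat),
     forall (S : finType) (M : matroid S) (w : S -> R) (Bmax Bstar : {set S})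
            (smax sstar : seq S) (delta : R),
       max_weight_basis M w Bmax -> basis M Bstar ->
       weight w Bstar < weight w Bmax ->
       perm_eq smax (enum Bmax) -> perm_eq sstar (enum Bstar) ->
       inverse_matroid_opt M Bstar w delta ->
       exists n : nat,
         eval w (indep M) [:: VPair (vlist R smax) (vlist R sstar)] P
           (VReal delta) n /\
         ((2 <= rank M)%N -> (n <= C * (rank M * up_log 2 (rank M)))%N)).
Proof.
split=> [S M w Bmax B maxBm bB lt|].
  have [f [e [fBm ex wef opt gain]]] := best_exchange maxBm bB lt.
  by exists f, e; split=> //; case/and3P: ex.
exists inverse_program, 1000 => S M w Bmax B smax sB delta maxBm bB lt psm psB opt.
have [f [e [fBm ex wef optfe _]]] := best_exchange maxBm bB lt.
have def_delta := inverse_matroid_opt_uniq opt optfe.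
(* An optimal [w'] has norm half the gain of [(f, e)], and every exchange bounds that norm from
   below by half its own gain. *)
have exchange_le f' e' : exchange M B f' e' -> w f' - w e' <= w f - w e.
  move=> ex'; case: optfe => [[w' maxB eq_d] _].
  by have := exchange_le_linf w maxB ex'; rewrite eq_d; lra.
have set_sB : [set x in sB] = B by apply/setP=> x; rewrite inE (perm_mem psB) mem_enum.
pose rho := [:: vlist R sB; VPair (vlist R smax) (vlist R sB)].
have [fs [n1 [sfs pfs e1 le1]]] := eval_sort w (indep M) rho smax.
have [ds [n2 [sds pds e2 le2]]] := eval_sort w (indep M) rho sB.
have mem_fs x : (x \in fs) = (x \in Bmax).
  by rewrite (perm_mem pfs) (perm_mem psm) mem_enum.
have mem_ds : catrev [::] ds =i B.
  by move=> x; rewrite (perm_mem pds) (perm_mem psB) mem_enum.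
(* The initial best gain 0 is admissible because the largest gain is positive. *)
have gain_ge0 : (0 : int)%:~R <= w f - w e by rewrite mulr0z; lra.
have [x xfs xB|best [n3 [e3 /andP[_ best_le] best_ge le3]]] :=
  eval_loop (ds := ds) (p := [::]) bB set_sB exchange_le (VPair (vlist R smax) (vlist R sB) :: [::])
    sfs sds mem_ds _ gain_ge0.
  (* For the empty prefix each element of [Bmax] is its own witness. *)
  exists x; split=> //; apply: indep_sub (basis_indep maxBm.1).
  apply/subsetP=> y; rewrite !inE orbF => /eqP->.
  by rewrite -mem_fs.
have def_best : best = w f - w e.
  by apply/eqP; rewrite eq_le best_le best_ge ?mem_fs.
eexists; split.
  have -> : delta = arith_op OpDiv best (2 : int)%:~R by rewrite def_delta def_best.
  apply: EvArith; last exact: EvConst.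
  apply: EvLet; first by ev.
  apply: EvApp; [ev| |exact: e3].
  apply: EvPair; apply: EvPair.
  - by apply: EvApp; [ev|ev|exact: e1].
  - exact: EvConst.
  - by apply: EvApp; [ev|ev|exact: e2].
  - by ev.
move=> r2.
rewrite (perm_size pfs) (perm_size pds) in le3.
rewrite (perm_size psm) -cardE (card_basis maxBm.1) in le1 le3.
rewrite (perm_size psB) -cardE (card_basis bB) in le2 le3.
(* For rank at least 2 the logarithm is positive, so the linear cost of the loop and all constants
   are absorbed. *)
have L0 : (0 < up_log 2 (rank M))%N by rewrite up_log_gt0.
have := leq_pmulr (rank M) L0.
by move: le1 le2 le3 r2; clear; move: (rank M * _)%N => N; lia.
Qed.
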